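(* Let $(X,q)$ be a $\delta$-symmetric quasi-metric space and let $T:X\to X$ be a $b$-Proinov-type $\mathcal{Z}$-contraction with respect to $\xi\in\mathcal{Z}$, with control functions $\zeta,\eta$. Suppose that: (i) $\zeta$ is nondecreasing; (ii) $\eta(t)<\zeta(t)$ for all $t\in \mathrm{Im}(q)\setminus\{0\}$; (iii) if $\{x_n\}$ and $\{y_n\}$ are two sequences in $(0,\infty)$ such that $\lim_{n\to\infty}x_n=\lim_{n\to\infty}y_n>0$, then $\lim_{n\to\infty}\zeta(x_n)=\lim_{n\to\infty}\zeta(y_n)>0$. Then $T$ has a unique fixed point in $X$, provided the space $X$ is $f$-complete. In this case, the sequence $\{T^nx\}$ $f$-converges to the fixed point for any $x\in X$.
   Context: A quasi-metric on a nonempty set $X$ is a function $q:X\times X\to\mathbb{R}$ such that for all $x,y,z\in X$: $q(x,y)\ge 0$; $q(x,y)=0$ if and only if $x=y$; $q(x,y)\le q(x,z)+q(z,y)$. The space $(X,q)$ is $\delta$-symmetric if there exists $\delta>0$ with $q(x,y)\le\delta q(y,x)$ for all $x,y\in X$. $\mathrm{Im}(q)$ denotes the range of $q$. A sequence $\{a_n\}$ $f$-converges to $a\in X$ if $q(a,a_n)\to 0$. A sequence $\{a_n\}$ is $f$-Cauchy if for every $\epsilon>0$ there is $N$ such that $q(a_m,a_n)<\epsilon$ for all $n\ge m\ge N$; $(X,q)$ is $f$-complete if every $f$-Cauchy sequence $f$-converges to a point of $X$. A simulation function is a map $\xi:[0,\infty)\times[0,\infty)\to\mathbb{R}$ such that: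 ($z_1$) $\xi(0,0)=0$; ($z_2$) $\xi(s,t)<t-s$ for all $s,t>0$; ($z_3$) for any sequences $\{s_n\},\{t_n\}$ in $(0,\infty)$ with $\lim_{n\to\infty}s_n=\lim_{n\to\infty}t_n>0$ one has $\limsup_{n\to\infty}\xi(s_n,t_n)<0$. $\mathcal{Z}$ is the set of all simulation functions. A map $T:X\to X$ is a $b$-Proinov-type $\mathcal{Z}$-contraction with respect to $\xi\in\mathcal{Z}$ if $\xi\big(\zeta(q(Tx,Ty)),\eta(q(y,x))\big)\ge 0$ for all $x,y\in X$, where $\zeta,\eta:(0,\infty)\to\mathbb{R}$ are two control functions with $\eta(t)<\zeta(t)$ for all $t\in\mathrm{Im}(q)\setminus\{0\}$.
   Formalization: Added hypothesis: η(q(y,x)) > 0 whenever Tx ≠ Ty. Without it the claim fails: on two points with the discrete metric take T the swap, ζ(t)=t, η=0, ξ(s,0)=0 and ξ(s,t)=t/2−s for t>0; all conditions hold but T has no fixed point. *)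

(* Defs.v *)
From Stdlib Require Import Reals.
From Coquelicot Require Import Coquelicot.
Open Scope R_scope.

Record quasi_metric (X : Type) (q : X -> X -> R) : Prop := {
  qm_nonempty : inhabited X;
  qm_ge0 : forall x y, 0 <= q x y;
  qm_eq0 : forall x y, q x y = 0 <-> x = y;
  qm_triangle : forall x y z, q x y <= q x z + q z y
}.

Definition delta_symmetric (X : Type) (q : X -> X -> R) : Prop :=
  exists delta : R, 0 < delta /\ forall x y, q x y <= delta * q y x.

Definition range (X : Type) (q : X -> X -> R) (t : R) : Prop :=
  exists x y, q x y = t.

Definition f_converges (X : Type) (q : X -> X -> R) (a : nat -> X) (l : X) : Prop :=
  is_lim_seq (fun n => q l (a n)) 0.

Definition f_cauchy (X : Type) (q : X -> X -> R) (a : nat -> X) : Prop :=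
  forall eps : R, 0 < eps ->
    exists N : nat, forall m n : nat,
      (N <= m)%nat -> (m <= n)%nat -> q (a m) (a n) < eps.

Definition f_complete (X : Type) (q : X -> X -> R) : Prop :=
  forall a : nat -> X, f_cauchy X q a -> exists l : X, f_converges X q a l.

(* A map on [0,oo) x [0,oo) is represented by a total function whose values
   outside that domain are unconstrained and never used. The limit superior
   is taken in the extended reals, so it may be -oo. *)
Record simulation_function (xi : R -> R -> R) : Prop := {
  sim_z1 : xi 0 0 = 0;
  sim_z2 : forall s t, 0 < s -> 0 < t -> xi s t < t - s;
  sim_z3 : forall (s t : nat -> R) (l : R),
    (forall n, 0 < s n) -> (forall n, 0 < t n) ->
    is_lim_seq s l -> is_lim_seq t l -> 0 < l ->
    Rbar_lt (LimSup_seq (fun n => xi (s n) (t n))) 0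
}.

(* [zeta] and [eta] are functions on (0,oo), and [xi] one on [0,oo) x [0,oo).
   Hence the inequality is required at the pairs where [q (T x) (T y)] and
   [q y x] are positive, that is where [T x <> T y], and there the arguments
   of [xi] must lie in its domain. *)
Record b_proinov_Z_contraction (X : Type) (q : X -> X -> R) (T : X -> X)
    (xi : R -> R -> R) (zeta eta : R -> R) : Prop := {
  bpz_control : forall t, range X q t -> t <> 0 -> eta t < zeta t;
  bpz_domain : forall x y, T x <> T y ->
    0 <= zeta (q (T x) (T y)) /\ 0 <= eta (q y x);
  bpz_contr : forall x y, T x <> T y ->
    0 <= xi (zeta (q (T x) (T y))) (eta (q y x))
}.

(* Main.v *)
Require Import Defs.
From Stdlib Require Import Reals Lra Lia Classical IndefiniteDescription.
From Coquelicot Require Import Coquelicot.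
Open Scope R_scope.

(** The hypotheses on the control functions matter only through two facts
    about [T], and the rest of the argument is pure quasi-metric geometry.

    - [T] is a flipped weak contraction: [q (T x) (T y) <= q y x]
      ([flip_nonexpansive]). Where [T x <> T y], condition (z2) gives
      [zeta (q (T x) (T y)) < eta (q y x) < zeta (q y x)], and [zeta] is
      nondecreasing.
    - [T] is strict in the limit: if [q (T (u n)) (T (v n))] and
      [q (v n) (u n)] have the same limit [l], then [l = 0]
      ([flip_limit_eq0]). Were [l] positive, the chain above and the limit
      hypothesis on [zeta] would force both arguments of [xi] to a common
      positive limit, so that (z3) would make the superior limit of [xi]
      negative although [xi] is nonnegative along the sequence.

    From these, all orbits are asymptotic to each other
    ([orbits_asymptotic]): swapping the two arguments at every step turns the
    distance between two orbits into a nonincreasing sequence, whose limit has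
    to vanish. In particular the steps of an orbit tend to [0], and the usual
    minimal-counterexample argument shows that the orbit is f-Cauchy
    ([orbit_f_cauchy]): a failure would squeeze both distances of the limit
    principle to the same positive number. The f-limit of an orbit is fixed by
    the flipped inequality ([f_limit_of_orbit_fixed]), and asymptoticity of
    orbits then gives uniqueness and convergence from every starting point. *)

(** * The two consequences of the contraction condition *)

Section Contraction.

Variables (X : Type) (q : X -> X -> R) (T : X -> X).
Variables (xi : R -> R -> R) (zeta eta : R -> R).
Hypothesis q_qm : quasi_metric X q.
Hypothesis xi_sim : simulation_function xi.
Hypothesis T_contr : b_proinov_Z_contraction X q T xi zeta eta.
Hypothesis eta_pos : forall x y : X, T x <> T y -> 0 < eta (q y x).
Hypothesis zeta_lim : forall (x y : nat -> R) (l : R),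
  (forall n, 0 < x n) -> (forall n, 0 < y n) ->
  is_lim_seq x l -> is_lim_seq y l -> 0 < l ->
  exists L : R, 0 < L /\
    is_lim_seq (fun n => zeta (x n)) L /\
    is_lim_seq (fun n => zeta (y n)) L.

(** Constant sequences turn the positivity of limits into a pointwise
    statement. *)
Lemma zeta_pos (s : R) : 0 < s -> 0 < zeta s.
Proof.
intros Hs.
destruct (zeta_lim (fun _ => s) (fun _ => s) s) as (L & HL & Hlim & _);
  auto using is_lim_seq_const.
apply is_lim_seq_unique in Hlim.
rewrite Lim_seq_const in Hlim.
injection Hlim as ->; exact HL.
Qed.

Lemma dist_pos (x y : X) : x <> y -> 0 < q x y.
Proof.
intros Hxy.
destruct (Rle_lt_or_eq_dec 0 (q x y) (qm_ge0 _ _ q_qm x y)) as [H | H]; auto.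
contradict Hxy; apply (qm_eq0 _ _ q_qm); auto.
Qed.

Lemma control_chain (x y : X) : T x <> T y ->
  zeta (q (T x) (T y)) < eta (q y x) < zeta (q y x).
Proof.
intros HT.
assert (Hyx : 0 < q y x) by (apply dist_pos; intros ->; auto).
split.
- pose proof (bpz_contr _ _ _ _ _ _ T_contr x y HT).
  pose proof (sim_z2 _ xi_sim _ _ (zeta_pos _ (dist_pos _ _ HT))
    (eta_pos x y HT)).
  lra.
- apply (bpz_control _ _ _ _ _ _ T_contr); [now exists y, x | lra].
Qed.

Lemma flip_nonexpansive
    (zeta_nondecreasing : forall s t : R, 0 < s -> s <= t -> zeta s <= zeta t)
    (x y : X) :
  q (T x) (T y) <= q y x.
Proof.
destruct (classic (T x = T y)) as [HT | HT].
- apply (qm_eq0 _ _ q_qm) in HT as ->; apply (qm_ge0 _ _ q_qm).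
- apply Rnot_lt_le; intros Hlt.
  assert (Hyx : 0 < q y x) by (apply dist_pos; intros ->; auto).
  pose proof (control_chain x y HT).
  pose proof (zeta_nondecreasing _ _ Hyx (Rlt_le _ _ Hlt)).
  lra.
Qed.

Lemma flip_limit_eq0_of_pos (u v : nat -> X) (l : R) :
  (forall n, 0 < q (T (u n)) (T (v n))) ->
  is_lim_seq (fun n => q (T (u n)) (T (v n))) l ->
  is_lim_seq (fun n => q (v n) (u n)) l ->
  ~ 0 < l.
Proof.
intros Hpos Hs Ht Hl.
assert (HT : forall n, T (u n) <> T (v n)).
{ intros n E; apply (qm_eq0 _ _ q_qm) in E.
  specialize (Hpos n); lra. }
assert (Hpos' : forall n, 0 < q (v n) (u n)).
{ intros n; apply dist_pos; intros E; apply (HT n); now rewrite E. }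
destruct (zeta_lim _ _ l Hpos Hpos' Hs Ht Hl) as (L & HL & Hzs & Hzt).
assert (Heta : is_lim_seq (fun n => eta (q (v n) (u n))) L).
{ refine (is_lim_seq_le_le _ _ _ _ _ Hzs Hzt).
  intros n; pose proof (control_chain _ _ (HT n)); lra. }
pose proof (sim_z3 _ xi_sim _ _ L (fun n => zeta_pos _ (Hpos n))
  (fun n => eta_pos _ _ (HT n)) Hzs Heta HL) as Hsup.
apply (Rbar_lt_not_le _ _ Hsup).
rewrite <- (LimSup_seq_const 0).
apply LimSup_le; exists 0%nat; intros n _.
apply (bpz_contr _ _ _ _ _ _ T_contr), HT.
Qed.

(** Condition (z3) and the hypothesis on [zeta] speak of sequences that are
    positive from the first term on, hence the passage to a tail. *)
Lemma flip_limit_eq0 (u v : nat -> X) (l : R) :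
  is_lim_seq (fun n => q (T (u n)) (T (v n))) l ->
  is_lim_seq (fun n => q (v n) (u n)) l ->
  l = 0.
Proof.
intros Hs Ht.
assert (Hl : 0 <= l).
{ refine (is_lim_seq_le (fun _ => 0) _ 0 l _ (is_lim_seq_const 0) Hs).
  intros n; apply (qm_ge0 _ _ q_qm). }
destruct (Rle_lt_or_eq_dec 0 l Hl) as [Hlt |]; auto.
exfalso; revert Hlt.
assert (Htail : 0 < l -> exists N, forall n, (N <= n)%nat ->
  0 < q (T (u n)) (T (v n))).
{ intros Hlt; apply is_lim_seq_spec in Hs.
  destruct (Hs (mkposreal l Hlt)) as [N HN]; exists N; intros n Hn.
  specialize (HN n Hn); simpl in HN; apply Rabs_def2 in HN; lra. }
intros Hlt; destruct (Htail Hlt) as [N HN].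
apply (is_lim_seq_incr_n _ N) in Hs; apply (is_lim_seq_incr_n _ N) in Ht.
apply (flip_limit_eq0_of_pos (fun n => u (n + N)%nat) (fun n => v (n + N)%nat)
  l); auto.
intros n; apply HN; lia.
Qed.

End Contraction.

(** * Orbits of a flipped weak contraction *)

Section Orbits.

Variables (X : Type) (q : X -> X -> R) (T : X -> X).
Hypothesis q_qm : quasi_metric X q.
Hypothesis T_flip : forall x y, q (T x) (T y) <= q y x.
Hypothesis T_limit : forall (u v : nat -> X) (l : R),
  is_lim_seq (fun n => q (T (u n)) (T (v n))) l ->
  is_lim_seq (fun n => q (v n) (u n)) l ->
  l = 0.

(** The orbit of [x] at even times and of [y] at odd times. Since
    [T (zigzag x y n)] is [zigzag y x (S n)], the flipped inequality compares
    consecutive terms of the single sequence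
    [q (zigzag x y n) (zigzag y x n)]. *)
Definition zigzag (x y : X) (n : nat) : X :=
  Nat.iter n T (if Nat.even n then x else y).

Lemma zigzag_S (x y : X) (n : nat) : zigzag x y (S n) = T (zigzag y x n).
Proof.
unfold zigzag; rewrite Nat.even_succ, <- Nat.negb_even.
now destruct (Nat.even n).
Qed.

Lemma zigzag_dist_lim0 (x y : X) :
  is_lim_seq (fun n => q (zigzag x y n) (zigzag y x n)) 0.
Proof.
set (c := fun n => q (zigzag x y n) (zigzag y x n)).
destruct (ex_finite_lim_seq_decr c 0) as [l Hl].
- intros n; unfold c; rewrite !zigzag_S; apply T_flip.
- intros n; apply (qm_ge0 _ _ q_qm).
- replace 0 with l; [exact Hl |].
  apply (T_limit (zigzag y x) (zigzag x y)); [| exact Hl].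
  apply is_lim_seq_incr_1 in Hl; revert Hl; apply is_lim_seq_ext.
  intros n; unfold c; now rewrite !zigzag_S.
Qed.

(** At each time the distance between the orbits is one of the two zigzag
    distances, so it is at most their sum. *)
Lemma orbits_asymptotic (x y : X) :
  is_lim_seq (fun n => q (Nat.iter n T x) (Nat.iter n T y)) 0.
Proof.
pose proof (is_lim_seq_plus' _ _ _ _ (zigzag_dist_lim0 x y)
  (zigzag_dist_lim0 y x)) as Hsum.
rewrite Rplus_0_r in Hsum.
refine (is_lim_seq_le_le (fun _ => 0) _ _ _ _ (is_lim_seq_const 0) Hsum).
intros n; split; [apply (qm_ge0 _ _ q_qm) |].
pose proof (qm_ge0 _ _ q_qm (zigzag x y n) (zigzag y x n)) as H1.
pose proof (qm_ge0 _ _ q_qm (zigzag y x n) (zigzag x y n)) as H2.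
unfold zigzag in *; destruct (Nat.even n); lra.
Qed.

Lemma orbit_steps_lim0 (x : X) :
  is_lim_seq (fun n => q (Nat.iter n T x) (Nat.iter (S n) T x)) 0.
Proof.
generalize (orbits_asymptotic x (T x)); apply is_lim_seq_ext.
intros n; now rewrite <- Nat.iter_succ_r.
Qed.

(** Choosing the first index at which the Cauchy bound fails makes the failure
    sharp: [q (a m) (a (S p))] exceeds [eps] by at most one step of the
    sequence, hence tends to [eps] once the steps tend to [0]. *)
Lemma not_f_cauchy_first_exit (a : nat -> X) :
  ~ f_cauchy X q a ->
  exists eps : R, 0 < eps /\ forall N : nat, exists m p : nat,
    (N <= m <= p)%nat /\ q (a m) (a p) < eps <= q (a m) (a (S p)).
Proof.
intros Hn.
apply not_all_ex_not in Hn as [eps Hn]; apply imply_to_and in Hn as [Heps Hn].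
exists eps; split; [exact Heps |]; intros N.
apply NNPP; intros Hno; apply Hn; exists N; intros m n HN Hmn.
induction Hmn as [| p Hmp IH].
- now rewrite (proj2 (qm_eq0 _ _ q_qm _ _) eq_refl).
- apply Rnot_le_lt; intros Hle; apply Hno; exists m, p; auto.
Qed.

(** A first exit time [p] from the ball of radius [eps] around the [m]-th point
    of the orbit gives the chain
    [eps - o(1) <= q (a (S m)) (a (S (S p))) <= q (a (S p)) (a m) <= eps + o(1)]
    for the orbit [a]. The flipped inequality serves both for the middle step
    and for the right one, where it leads back to [q (a (m - 1)) (a p)]; this
    is why [m] is taken of the form [S k]. *)
Lemma orbit_f_cauchy (x : X) : f_cauchy X q (fun n => Nat.iter n T x).
Proof.
apply NNPP; intros Hn.
destruct (not_f_cauchy_first_exit _ Hn) as (eps & Heps & Hexit).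
set (a := fun n => Nat.iter n T x) in *.
assert (Hexit' : forall N, exists kp : nat * nat,
  (N <= fst kp < snd kp)%nat /\
  q (a (S (fst kp))) (a (snd kp)) < eps <= q (a (S (fst kp))) (a (S (snd kp)))).
{ intros N; destruct (Hexit (S N)) as (m & p & Hmp & Hq).
  destruct m as [| k]; [lia |].
  exists (k, p); simpl; split; [lia | exact Hq]. }
destruct (functional_choice _ Hexit') as [kp Hkp].
set (k := fun n => fst (kp n)); set (p := fun n => snd (kp n)).
assert (Hk : forall n, (n <= k n < p n)%nat) by (intros n; apply Hkp).
set (d := fun n => q (a n) (a (S n))).
assert (Hd : forall f : nat -> nat, (forall n, (n <= f n)%nat) ->
  is_lim_seq (fun n => d (f n)) 0).
{ intros f Hf.
  apply (is_lim_seq_subseq d 0 f); [| apply orbit_steps_lim0].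
  intros P [N HN]; exists N; intros n HNn; apply HN.
  specialize (Hf n); lia. }
assert (Hchain : forall n,
  eps - (d (S (k n)) + d (p n)) <= q (a (S (S (k n)))) (a (S (S (p n)))) /\
  q (a (S (S (k n)))) (a (S (S (p n)))) <= q (a (S (p n))) (a (S (k n))) /\
  q (a (S (p n))) (a (S (k n))) <= eps + d (k n)).
{ intros n.
  destruct (Hkp n) as [_ [Hlt Hge]]; fold (k n) (p n) in Hlt, Hge.
  pose proof (qm_triangle _ _ q_qm (a (S (k n))) (a (S (p n)))
    (a (S (S (k n))))).
  pose proof (qm_triangle _ _ q_qm (a (S (S (k n)))) (a (S (p n)))
    (a (S (S (p n))))).
  pose proof (T_flip (a (S (p n))) (a (p n))).
  pose proof (T_flip (a (S (k n))) (a (S (p n)))).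
  pose proof (T_flip (a (p n)) (a (k n))).
  pose proof (qm_triangle _ _ q_qm (a (k n)) (a (p n)) (a (S (k n)))).
  unfold d; change (T (a (S (k n)))) with (a (S (S (k n)))) in *.
  change (T (a (k n))) with (a (S (k n))) in *.
  change (T (a (S (p n)))) with (a (S (S (p n)))) in *.
  change (T (a (p n))) with (a (S (p n))) in *.
  lra. }
assert (Hlow : is_lim_seq (fun n => eps - (d (S (k n)) + d (p n))) eps).
{ replace (Finite eps) with (Finite (eps - (0 + 0))) by (f_equal; ring).
  apply is_lim_seq_minus'; [apply is_lim_seq_const |].
  apply is_lim_seq_plus'.
  - apply (Hd (fun n => S (k n))); intros n; specialize (Hk n); lia.
  - apply Hd; intros n; specialize (Hk n); lia. }
assert (Hup : is_lim_seq (fun n => eps + d (k n)) eps).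
{ replace (Finite eps) with (Finite (eps + 0)) by (f_equal; ring).
  apply is_lim_seq_plus'; [apply is_lim_seq_const |].
  apply Hd; intros n; apply Hk. }
enough (eps = 0) by lra.
apply (T_limit (fun n => a (S (k n))) (fun n => a (S (p n)))).
- refine (is_lim_seq_le_le _ _ _ _ _ Hlow Hup).
  intros n; destruct (Hchain n) as (H1 & H2 & H3); simpl in *; lra.
- refine (is_lim_seq_le_le _ _ _ _ _ Hlow Hup).
  intros n; destruct (Hchain n) as (H1 & H2 & H3); simpl in *; lra.
Qed.

(** The flip works in favour of f-convergence: [q (T (a n)) (T l)] is bounded
    by [q l (a n)], the very quantity that tends to [0], so that both halves
    of the path from [l] to [T l] through [T (a n)] vanish in the limit. *)
Lemma f_limit_of_orbit_fixed (x l : X) :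
  f_converges X q (fun n => Nat.iter n T x) l -> T l = l.
Proof.
intros Hl; unfold f_converges in Hl.
symmetry; apply (qm_eq0 _ _ q_qm).
apply Rle_antisym; [| apply (qm_ge0 _ _ q_qm)].
pose proof (is_lim_seq_plus' _ _ _ _ (proj1 (is_lim_seq_incr_1 _ _) Hl) Hl)
  as Hsum.
rewrite Rplus_0_r in Hsum.
refine (is_lim_seq_le (fun _ => q l (T l)) _ (q l (T l)) 0 _
  (is_lim_seq_const _) Hsum).
intros n; simpl.
pose proof (qm_triangle _ _ q_qm l (T l) (T (Nat.iter n T x))).
pose proof (T_flip (Nat.iter n T x) l).
lra.
Qed.

Lemma orbits_f_converge_to_fixed (l x : X) :
  T l = l -> f_converges X q (fun n => Nat.iter n T x) l.
Proof.
intros Hl; generalize (orbits_asymptotic l x); apply is_lim_seq_ext.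
intros n; f_equal.
induction n as [| n IH]; simpl; [reflexivity | now rewrite IH].
Qed.

Lemma fixed_point_unique (l l' : X) : T l = l -> T l' = l' -> l = l'.
Proof.
intros Hl Hl'.
apply (qm_eq0 _ _ q_qm).
pose proof (T_flip l l') as H1; pose proof (T_flip l' l) as H2.
rewrite Hl, Hl' in H1, H2.
apply (T_limit (fun _ => l) (fun _ => l')); rewrite ?Hl, ?Hl'.
- apply is_lim_seq_const.
- replace (q l' l) with (q l l') by lra; apply is_lim_seq_const.
Qed.

End Orbits.

(** * The fixed point theorem *)

(* [eta_pos] excludes [eta (q y x) = 0], where (z2) says nothing about
   [xi s 0] and the conclusion can fail. *)
Theorem theorem3p2 (X : Type) (q : X -> X -> R) (T : X -> X)
    (xi : R -> R -> R) (zeta eta : R -> R)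
    (q_qm : quasi_metric X q)
    (q_sym : delta_symmetric X q)
    (xi_sim : simulation_function xi)
    (T_contr : b_proinov_Z_contraction X q T xi zeta eta)
    (eta_pos : forall x y : X, T x <> T y -> 0 < eta (q y x))
    (zeta_nondecreasing : forall s t : R, 0 < s -> s <= t -> zeta s <= zeta t)
    (eta_lt_zeta : forall t : R, range X q t -> t <> 0 -> eta t < zeta t)
    (zeta_lim : forall (x y : nat -> R) (l : R),
      (forall n, 0 < x n) -> (forall n, 0 < y n) ->
      is_lim_seq x l -> is_lim_seq y l -> 0 < l ->
      exists L : R, 0 < L /\
        is_lim_seq (fun n => zeta (x n)) L /\
        is_lim_seq (fun n => zeta (y n)) L)
    (q_complete : f_complete X q) :
  exists a : X,
    unique (fun z => T z = z) a /\
    forall x : X, f_converges X q (fun n => Nat.iter n T x) a.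
Proof.
pose proof (flip_nonexpansive X q T xi zeta eta q_qm xi_sim T_contr eta_pos
  zeta_lim zeta_nondecreasing) as T_flip.
pose proof (flip_limit_eq0 X q T xi zeta eta q_qm xi_sim T_contr eta_pos
  zeta_lim) as T_limit.
destruct (qm_nonempty _ _ q_qm) as [x0].
destruct (q_complete _ (orbit_f_cauchy X q T q_qm T_flip T_limit x0))
  as [a Ha].
pose proof (f_limit_of_orbit_fixed X q T q_qm T_flip x0 a Ha) as Hfix.
exists a; split; [split |].
- exact Hfix.
- intros b Hb; exact (fixed_point_unique X q T q_qm T_flip T_limit a b Hfix Hb).
- intros x; exact (orbits_f_converge_to_fixed X q T q_qm T_flip T_limit a x
    Hfix).
Qed.
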